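(* Let $N\geq 1$ be an integer, $0<\epsilon<1$, and $0<\gamma\leq 1/2$. Let $x_0,\ldots,x_{N-1}$ be real numbers satisfying $|x_j - j/N|\leq \gamma/N$ for $0\leq j\leq N-1$, and let $\omega_0,\ldots,\omega_{N-1}\in[0,N]$. Consider the $N\times N$ matrix \[ A_{jk} = e^{-2\pi i (x_j-j/N)\omega_k}, \qquad 0\leq j,k\leq N-1. \] Then there exists a matrix $A_K$ of rank (at most) $K$ such that $\|A-A_K\|_{\max}\leq \epsilon$, where \[ K = \max\left\{3, \Big\lceil 5\gamma\, e^{W\left(\log(140/\epsilon)/(5\gamma)\right)}\Big\rceil\right\}, \] and $K = \mathcal{O}\left(\log(1/\epsilon)/\log\log(1/\epsilon)\right)$ as $\epsilon\to 0$.
   Context: $\|B\|_{\max}=\max_{j,k}|B_{jk}|$ denotes the absolute maximum entry of a matrix $B$. $W$ denotes the Lambert W function (principal branch), and $\lceil t\rceil$ is the smallest integer $\ge t$. *)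

(* Defs.v *)
From HB Require Import structures.
From mathcomp Require Import all_boot all_order all_algebra.
From mathcomp Require Import all_classical all_reals all_analysis.
From mathcomp Require Import complex.
Import Order.TTheory GRing.Theory Num.Theory.
Local Open Scope ring_scope.
Local Open Scope complex_scope.

Definition cexpi {R : realType} (theta : R) : R[i] := cos theta +i* sin theta.

(* Lambert W, principal branch: for x >= -1/e, the unique w >= -1 with
   w e^w = x (junk value outside that domain). *)
Definition LambertW {R : realType} (x : R) : R :=
  xget 0 [set w : R | -1 <= w /\ w * expR w = x].

Definition mx_maxnorm {R : realType} {m n : nat} (B : 'M[R[i]]_(m, n)) : R :=
  \big[Num.max/0]_(j < m) \big[Num.max/0]_(k < n) Normc.normc (B j k).

Definition Amat {R : realType} (N : nat) (x om : 'I_N -> R) : 'M[R[i]]_N :=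
  \matrix_(j < N, k < N)
     cexpi (- (2 * pi * ((x j - (j : nat)%:R / N%:R) * om k))).

Definition Kbound {R : realType} (gamma eps : R) : int :=
  Num.max 3%:Z
    (Num.ceil (5 * gamma * expR (LambertW (ln (140 / eps) / (5 * gamma))))).

(* Main.v *)
Require Import Defs.
From HB Require Import structures.
From mathcomp Require Import all_boot all_order all_algebra.
From mathcomp Require Import all_classical all_reals all_analysis.
From mathcomp Require Import complex.
From mathcomp Require Import ring lra zify.
Import Order.TTheory GRing.Theory Num.Theory.
Local Open Scope ring_scope.
Import numFieldNormedType.Exports.
Local Open Scope classical_set_scope.

(** Put [theta_j = - pi (N x_j - j)] and [s_k = 2 om_k / N - 1 = cos phi_k],
    so that [A_jk = cexpi theta_j * cexpi (theta_j cos phi_k)].  Expand the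
    second factor in powers of [theta_j cos phi_k] and rewrite each power
    through [(2 cos phi)^n = \sum_b C(n,b) cos ((n - 2b) phi)].  The frequencies
    [|n - 2b| < K] contribute a matrix of rank at most [K]; the others contribute
    at most [2 (h^K / K!) e^(2h)] to each of the cosine and sine series, where
    [h = pi gamma / 2].  Expanding in cosines instead of monomials is what gains
    the factor [2^-K]: with [K^K <= 3^K K!] and [pi <= 10/3] one gets
    [h^K / K! <= (5 gamma / K)^K], which the Lambert choice of [K] makes at most
    [eps / 140]. *)

(** * Numerical estimates for exponentials, factorials and [pi] *)

Lemma sum_exprn_fact_le_expR {R : realType} (x : R) (n : nat) :
  0 <= x -> \sum_(i < n) x ^+ i / i`!%:R <= expR x.
Proof.
move=> x0; rewrite -(big_mkord xpredT (fun i => x ^+ i / i`!%:R)).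
apply: (@nondecreasing_cvgn_le R (series (exp_coeff x))).
  by apply: nondecreasing_series => i _ _; rewrite /exp_coeff /= divr_ge0 ?exprn_ge0.
exact: is_cvg_series_exp_coeff.
Qed.

(** The sixth power of [1 - 1/6 <= expR (- (1/6))] gives [e <= (6/5)^6 < 3]. *)
Lemma expR1_le3 {R : realType} : expR 1 <= 3 :> R.
Proof.
have h : 5 / 6 <= expR (- (1 / 6)) :> R.
  by apply: le_trans (expR_ge1Dx _); lra.
have h6 : (5 / 6) ^+ 6 <= expR (- 1) :> R.
  have -> : - 1 = - (1 / 6) * 6%:R :> R by lra.
  by rewrite expRM_natr lerXn2r// nnegrE ?expR_ge0//; lra.
have e0 := expR_gt0 (1 : R).
have e1 : expR (- 1) * expR 1 = 1 :> R by rewrite -expRD addNr expR0.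
have : (5 / 6) ^+ 6 * expR 1 <= 1 :> R by rewrite -[leRHS]e1; apply: ler_wpM2r => //; exact: ltW.
by rewrite !exprS expr0 => ?; lra.
Qed.

(** [n^n / n!] is a single term of the series of [e^n], and [e <= 3]. *)
Lemma exprn_le_expR_fact {R : realType} (n : nat) :
  n%:R ^+ n <= 3 ^+ n * n`!%:R :> R.
Proof.
case: n => [|n]; first by rewrite !expr0 fact0 mulr1.
have := @expR_ge1Dxn R n.+1%:R n (ler0n _ _).
have -> : expR n.+1%:R = expR 1 ^+ n.+1 :> R by rewrite -expRM_natr mul1r.
have f0 : 0 < (n.+1)`!%:R :> R by rewrite ltr0n fact_gt0.
rewrite -ler_pdivrMr// => h; apply: le_trans (_ : expR 1 ^+ n.+1 <= _).
  by apply: le_trans h; rewrite lerDr.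
by rewrite lerXn2r ?nnegrE ?expR_ge0 ?expR1_le3.
Qed.

Lemma sin_MVT {R : realType} (x : R) :
  0 <= x -> exists2 c, 0 <= c <= x & sin x = cos c * x.
Proof.
move=> x0; have [|c] := @MVT_segment R sin cos 0 x x0 (fun y _ => is_derive_sin y).
  by apply: continuous_subspaceT => y; exact: continuous_sin.
by rewrite in_itv/= sin0 !subr0 => c0x ->; exists c.
Qed.

Lemma cosMn2_sin {R : realType} (x : R) : cos (x + x) = 1 - 2 * sin x ^+ 2.
Proof. by rewrite cosD -!expr2 cos2sin2; ring. Qed.

Lemma cos_ge1B {R : realType} (x : R) : 0 <= x -> 1 - x ^+ 2 / 2 <= cos x.
Proof.
move=> x0; have h : 0 <= x / 2 by lra.
have [c _ e] := sin_MVT _ h.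
rewrite [in cos x](splitr x) cosMn2_sin e.
have : cos c ^+ 2 <= 1 by rewrite cos2sin2 gerBl sqr_ge0.
by have := sqr_ge0 x; rewrite exprMn; nra.
Qed.

(** If [pi > 10/3], then [cos] is positive on [[0, 5/3]]. Doubling the angle three times from [5/24]
    yields upper bounds on [cos], the positivity allowing them to be squared, and the last one makes
    [cos (5/3)] negative. *)
Lemma pi_le_10_3 {R : realType} : pi <= 10 / 3 :> R.
Proof.
rewrite leNgt; apply/negP => hpi.
have [c /andP[c0 c1] e] := @sin_MVT R (5 / 24) ltac:(lra).
have : 1 - (5 / 24) ^+ 2 / 2 <= cos c.
  by apply: le_trans (cos_ge1B _ c0); nra.
move=> hc.
have s1 : 203 / 1000 <= sin (5 / 24 : R) by rewrite e; nra.
have s2 : cos (5 / 12 : R) <= 918 / 1000.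
  have -> : 5 / 12 = 5 / 24 + 5 / 24 :> R by lra.
  by rewrite cosMn2_sin; nra.
have cp (y : R) : 0 <= y <= 5 / 3 -> 0 < cos y.
  by move=> hy; apply: cos_gt0_pihalf; lra.
have h1 := cp (5 / 12) ltac:(lra).
have s3 : cos (5 / 6 : R) <= 686 / 1000.
  have -> : 5 / 6 = (5 / 12) *+ 2 :> R by rewrite mulr2n; lra.
  by rewrite cos_mulr2n mulr2n; nra.
have h2 := cp (5 / 6) ltac:(lra).
have := cp (5 / 3) ltac:(lra).
have -> : 5 / 3 = (5 / 6) *+ 2 :> R by rewrite mulr2n; lra.
by rewrite cos_mulr2n mulr2n; nra.
Qed.

(** * The Lambert function at positive arguments *)

(** Since [y <= y * expR y], the intermediate value theorem on [[0, y]] provides a solution, so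
    [xget] returns an element of the set and not its default. Its sign is read off from
    [w * expR w = y > 0]. *)
Lemma LambertW_gt0 {R : realType} (y : R) : 0 < y ->
  0 < LambertW y /\ LambertW y * expR (LambertW y) = y.
Proof.
move=> y0.
have : exists w : R, [set w : R | -1 <= w /\ w * expR w = y] w.
  have [||w] := @IVT R (fun w => w * expR w) 0 y y (ltW y0).
  - apply: continuous_subspaceT => w; apply: cvgM; first exact: cvg_id.
    exact: continuous_expR.
  - have h : y <= y * expR y.
      by rewrite ler_peMr ?(ltW y0)//; apply: ltW; rewrite expR_gt1.
    by rewrite mul0r ge_min le_max (ltW y0) h orbT.
  by rewrite in_itv/= => /andP[w0 _] e; exists w; split => //; apply: le_trans w0; lra.
move=> /(xgetPex 0) [_ e]; rewrite -/(LambertW y) in e *; split => //.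
by rewrite -(pmulr_lgt0 _ (expR_gt0 (LambertW y))) e.
Qed.

(** * Cosine expansion of powers and its high-frequency tail *)

(** The free phase [a] carries the induction: [2 cos p cos a = cos (a + p) + cos (a - p)], and the
    two resulting sums merge by Pascal's rule. *)
Lemma exprn_cos_mul {R : realType} (n : nat) (p a : R) :
  2 ^+ n * cos p ^+ n * cos a =
  \sum_(b < n.+1) 'C(n, b)%:R * cos (a + (n%:R - b%:R *+ 2) * p).
Proof.
elim: n a => [|n IH] a.
  by rewrite big_ord1 !expr0 bin0 !mul1r mul0rn subr0 mul0r addr0.
have -> : 2 ^+ n.+1 * cos p ^+ n.+1 * cos a =
    2 ^+ n * cos p ^+ n * cos (a + p) + 2 ^+ n * cos p ^+ n * cos (a - p).
  by rewrite !exprS cosB cosD; ring.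
rewrite !IH [RHS]big_ord_recl /=.
under [X in _ = _ + X]eq_bigr => b _ do rewrite /bump /= add1n binS natrD mulrDl.
rewrite big_split /= addrA; congr (_ + _); last first.
  apply: eq_bigr => b _; congr (_ * cos _).
  by rewrite -!natr1 !mulr2n; ring.
(* The added term has coefficient ['C(n, n.+1) = 0]; it makes the two sums equally long. *)
transitivity
  (\sum_(i < n.+2) 'C(n, i)%:R * cos (a + (n.+1%:R - i%:R *+ 2) * p)); last first.
  by rewrite [LHS]big_ord_recl /= !bin0; congr (_ + _).
rewrite [RHS]big_ord_recr /= bin_small// mul0r addr0.
by apply: eq_bigr => b _; congr (_ * cos _); rewrite -natr1; ring.
Qed.

(* [|n - 2 b|]: subtraction is truncated, so one of the two terms vanishes. *)
Definition freq (n b : nat) : nat := ((n - b.*2) + (b.*2 - n))%N.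

Lemma exprn_cos {R : realType} (n : nat) (p : R) :
  2 ^+ n * cos p ^+ n = \sum_(b < n.+1) 'C(n, b)%:R * cos ((freq n b)%:R * p).
Proof.
have := @exprn_cos_mul R n p 0; rewrite cos0 mulr1 => ->.
apply: eq_bigr => b _; congr (_ * _); rewrite add0r /freq.
have [h|/ltnW h] := leqP b.*2 n.
  by rewrite (eqP h) addn0 natrB// -muln2 natrM mulr_natr.
by rewrite (eqP h) add0n natrB// -[LHS]cosN -muln2 natrM mulr_natr -mulNr opprB.
Qed.

(** The coefficients [g] are fixed before [p]: this separation of variables is the source of the low
    rank. Only frequencies at least [K] are lost, each cosine costing at most 1. *)
Lemma chebyshev_truncation {R : realType} (c : nat -> R) (M K : nat) (x : R) :
  exists g : nat -> R, forall p : R,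
  `|\sum_(n < M) c n * (x * cos p) ^+ n - \sum_(m < K) g m * cos (m%:R * p)| <=
  \sum_(n < M) `|c n| * (`|x| / 2) ^+ n *
    (\sum_(b < n.+1 | (K <= freq n b)%N) 'C(n, b))%:R.
Proof.
pose t n b : R := c n * (x / 2) ^+ n * 'C(n, b)%:R.
exists (fun m => \sum_(n < M) \sum_(b < n.+1 | freq n b == m) t n b) => p.
have -> : \sum_(n < M) c n * (x * cos p) ^+ n =
    \sum_(n < M) \sum_(b < n.+1) t n b * cos ((freq n b)%:R * p).
  apply: eq_bigr => n _.
  have -> : (x * cos p) ^+ n = (x / 2) ^+ n * (2 ^+ n * cos p ^+ n).
    by rewrite -!exprMn; congr (_ ^+ _); field.
  by rewrite exprn_cos !mulr_sumr; apply: eq_bigr => b _; rewrite /t !mulrA.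
have -> : \sum_(m < K) (\sum_(n < M) \sum_(b < n.+1 | freq n b == m) t n b) *
      cos (m%:R * p) =
    \sum_(n < M) \sum_(b < n.+1 | (freq n b < K)%N) t n b * cos ((freq n b)%:R * p).
  under eq_bigr => m _ do rewrite mulr_suml.
  rewrite exchange_big; apply: eq_bigr => n _ /=.
  under eq_bigr => m _ do rewrite mulr_suml big_mkcond.
  rewrite exchange_big [RHS]big_mkcond /=; apply: eq_bigr => b _.
  case: ifPn => [h|]; last first.
    rewrite -leqNgt => h; apply: big1 => m _; case: eqP => // e.
    by have := ltn_ord m; rewrite -e ltnNge h.
  rewrite (bigD1 (Ordinal h)) //= eqxx big1 ?addr0// => m hm.
  by case: eqP => // e; case/eqP: hm; apply: val_inj.
rewrite -sumrB; apply: le_trans (ler_norm_sum _ _ _) _; apply: ler_sum => n _.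
rewrite (bigID (fun b : 'I_n.+1 => (freq n b < K)%N)) /= addrAC subrr add0r.
apply: le_trans (ler_norm_sum _ _ _) _.
rewrite natr_sum mulr_sumr [leLHS]big_mkcond [leRHS]big_mkcond /=.
apply: ler_sum => b _; rewrite -leqNgt; case: ifP => // _.
rewrite /t !normrM normrX normrM normfV !normr_nat.
apply: ler_piMr; last by rewrite ler_norml cos_geN1 cos_le1.
by rewrite !mulr_ge0 ?exprn_ge0 ?divr_ge0.
Qed.

(* From [C(K+p, K+c) C(K+c, K) = C(K+p, K) C(p, c)]. *)
Lemma bin_add_le_mul (K p c : nat) :
  ('C(K + p, K + c) <= 'C(K + p, K) * 'C(p, c))%N.
Proof.
have [cp|pc] := leqP c p; last by rewrite bin_small// ltn_add2l.
have e1 := @bin_fact (K + p)%N (K + c)%N ltac:(lia).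
have e2 := @bin_fact (K + p)%N K ltac:(lia).
have e3 := @bin_fact p c cp.
have e4 := @bin_fact (K + c)%N K ltac:(lia).
have -> : ('C(K + p, K) * 'C(p, c) = 'C(K + p, K + c) * 'C(K + c, K))%N.
  have d1 : (K + p - (K + c) = p - c)%N by lia.
  have d2 : (K + p - K = p)%N by lia.
  have d3 : (K + c - K = c)%N by lia.
  rewrite d1 in e1; rewrite d2 in e2; rewrite d3 in e4.
  have f0 : (0 < K`! * (c`! * (p - c)`!))%N by rewrite !muln_gt0 !fact_gt0.
  apply/eqP; rewrite -(eqn_pmul2r f0).
  apply/eqP; transitivity (K + p)`!%N; first by rewrite -e2 -e3; ring.
  by rewrite -e1 -e4; ring.
by rewrite leq_pmulr// bin_gt0; lia.
Qed.

(** With [n = K + p] and [b = K + c], the bound [bin_add_le_mul] leaves the full row sum of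
    ['C(p, c)], which is [2 ^ p]. *)
Lemma sum_bin_upper (n K : nat) :
  (\sum_(b < n.+1 | K <= b) 'C(n, b) <= 'C(n, K) * 2 ^ (n - K))%N.
Proof.
have [Kn|nK] := leqP K n; last first.
  by rewrite big1// => b h; have := ltn_ord b; lia.
rewrite -(subnKC Kn) addKn; set p := (n - K)%N; rewrite -addnS big_mkcond /=.
rewrite big_split_ord /= big1 ?add0n => [|b _]; last first.
  by case: ifP => //; have := ltn_ord b; lia.
rewrite -[2%N]/(1 + 1)%N expnDn big_distrr; apply: leq_sum => c _ /=.
by rewrite leq_addr !exp1n !muln1 bin_add_le_mul.
Qed.

(** [|n - 2b| >= K] forces [b >= K] or [n - b >= K]; the two cases are exchanged by the symmetry
    [b -> n - b]. *)
Lemma sum_bin_freq (n K : nat) :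
  (\sum_(b < n.+1 | K <= freq n b) 'C(n, b) <= 2 * ('C(n, K) * 2 ^ (n - K)))%N.
Proof.
rewrite mul2n -addnn.
apply: (@leq_trans (\sum_(b < n.+1 | K <= b) 'C(n, b) +
                    \sum_(b < n.+1 | K <= n - b) 'C(n, b))%N).
  rewrite !(big_mkcond (fun b : 'I_n.+1 => leq _ _)) -big_split /=.
  apply: leq_sum => b _; have := ltn_ord b; rewrite /freq => hb.
  by do 3 case: ifPn => ?; lia.
apply: leq_add; first exact: sum_bin_upper.
rewrite (reindex_inj rev_ord_inj) /=.
apply: leq_trans (sum_bin_upper n K); rewrite leq_eqVlt; apply/orP; left; apply/eqP.
apply: eq_big => b /=; have hb : (b <= n)%N by rewrite -ltnS.
  by rewrite subSS subKn.
by rewrite subSS bin_sub.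
Qed.

(** As ['C(K+i, K) / (K+i)! = 1 / (K! i!)], the factor [h^K / K!] comes out and the terms
    [(2h)^i / i!] that remain are bounded by [expR (2h)]. *)
Lemma chebyshev_tail {R : realType} (c : nat -> R) (M K : nat) (h : R) :
  0 <= h -> (forall n, `|c n| <= (n`!%:R)^-1) ->
  \sum_(n < M) `|c n| * h ^+ n *
    (\sum_(b < n.+1 | (K <= freq n b)%N) 'C(n, b))%:R <=
  2 * (h ^+ K / K`!%:R) * expR (h *+ 2).
Proof.
move=> h0 hc.
pose F n : R := h ^+ n / n`!%:R * (2 * ('C(n, K) * 2 ^ (n - K)))%N%:R.
apply: (@le_trans _ _ (\sum_(n < M) F n)).
  apply: ler_sum => n _; apply: ler_pM; rewrite ?mulr_ge0 ?exprn_ge0//.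
    by rewrite mulrC ler_wpM2l ?exprn_ge0.
  by rewrite ler_nat sum_bin_freq.
have f0 n : n`!%:R != 0 :> R by rewrite pnatr_eq0 -lt0n fact_gt0.
have r0 : 0 <= 2 * (h ^+ K / K`!%:R).
  by rewrite mulr_ge0// divr_ge0 ?exprn_ge0.
have [MK|/ltnW KM] := leqP M K.
  rewrite big1 ?(mulr_ge0 r0 (expR_ge0 _))// => n _; rewrite /F bin_small ?mul0n ?muln0 ?mulr0//.
  by apply: leq_trans MK.
rewrite -(subnKC KM) big_split_ord /= big1 ?add0r => [|n _]; last first.
  by rewrite /F bin_small ?mul0n ?muln0 ?mulr0.
have -> : \sum_(i < M - K) F (K + i)%N =
    2 * (h ^+ K / K`!%:R) * \sum_(i < M - K) (h *+ 2) ^+ i / i`!%:R.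
  rewrite mulr_sumr; apply: eq_bigr => i _; rewrite /F addKn !natrM natrX.
  have e := @bin_fact (K + i)%N K (leq_addr _ _); rewrite addKn in e.
  have /(congr1 (fun k => k%:R : R)) := e; rewrite !natrM => e'.
  have -> : (h *+ 2) ^+ i = h ^+ i * 2 ^+ i by rewrite -exprMn mulr_natr.
  rewrite exprD -e'.
  have b0 : 'C(K + i, K)%:R != 0 :> R by rewrite pnatr_eq0 -lt0n bin_gt0 leq_addr.
  by field; rewrite !f0 b0.
by rewrite ler_wpM2l// sum_exprn_fact_le_expR// mulrn_wge0.
Qed.

(** * Size of [Kbound]: smallness of the tail and asymptotic growth *)

Lemma Kbound_ge3 {R : realType} (gamma e : R) : 3%:Z <= Kbound gamma e.
Proof. by rewrite /Kbound le_max lexx. Qed.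

(** Compares [Kbound] with the real number [k = 5 gamma e^w], which solves
    [k ln (k / (5 gamma)) = ln (140 / eps)]. *)
Lemma Kbound_LambertW {R : realType} (gamma eps : R) :
  0 < eps < 1 -> 0 < gamma ->
  exists w : R, [/\ 0 < w, w * (5 * gamma * expR w) = ln (140 / eps),
    5 * gamma * expR w <= (Kbound gamma eps)%:~R &
    (Kbound gamma eps)%:~R <= 3 + 5 * gamma * expR w].
Proof.
move=> /andP[e0 e1] g0; have g5 : 0 < 5 * gamma by lra.
have L0 : 0 < ln (140 / eps).
  by apply: ln_gt0; rewrite ltr_pdivlMr//; lra.
have [w0 we] := LambertW_gt0 _ (divr_gt0 L0 g5).
rewrite /Kbound; set w := LambertW _ in w0 we *; exists w; split => //.
- by rewrite mulrCA we mulrC divfK// gt_eqF.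
- by apply: le_trans (ceil_ge _) _; rewrite ler_int le_max lexx orbT.
have k0 : 0 <= 5 * gamma * expR w by rewrite mulr_ge0 ?expR_ge0 ?ltW.
have /andP[h _] := ceil_itv (5 * gamma * expR w).
move: h; rewrite intrB => h.
by rewrite /Order.max/=; case: ifP => _; lra.
Qed.

(** For [q = K / (5 gamma)], both [ln q >= w] and [K >= 5 gamma e^w], so
    [K ln q >= ln (140 / eps)]. *)
Lemma Kbound_pow {R : realType} (gamma eps : R) (K : nat) :
  0 < eps < 1 -> 0 < gamma -> K%:Z = Kbound gamma eps ->
  (5 * gamma / K%:R) ^+ K <= eps / 140.
Proof.
move=> he g0 eK; have [w [w0 we Kw _]] := Kbound_LambertW _ _ he g0.
have g5 : 0 < 5 * gamma by lra.
have e0 : 0 < eps by lra.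
rewrite -eK -pmulrn in Kw.
have K0 : 0 < K%:R :> R by apply: lt_le_trans Kw; rewrite mulr_gt0 ?expR_gt0.
set q := K%:R / (5 * gamma).
have q0 : 0 < q by rewrite divr_gt0.
have wq : w <= ln q.
  rewrite -(expRK w) ler_ln ?posrE ?expR_gt0//.
  by rewrite ler_pdivlMr// mulrC.
have : 140 / eps <= q ^+ K.
  rewrite -(lnK q0) -expRM_natr -[leLHS]lnK ?posrE ?divr_gt0// ler_expR -we.
  by rewrite ler_pM// ltW// mulr_gt0 ?expR_gt0.
move=> h; have -> : 5 * gamma / K%:R = q^-1 by rewrite /q invf_div.
by rewrite exprVn -[eps / 140]invf_div lef_pV2 ?posrE ?exprn_gt0 ?divr_gt0.
Qed.

Lemma Kbound_tail {R : realType} (gamma eps : R) (K : nat) :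
  0 < eps < 1 -> 0 < gamma <= 1 / 2 -> K%:Z = Kbound gamma eps ->
  2 * ((pi * gamma / 2) ^+ K / K`!%:R) * expR ((pi * gamma / 2) *+ 2) <= eps / 7.
Proof.
move=> he /andP[g0 g1] eK.
have hp := Kbound_pow _ _ _ he g0 eK.
have p0 := @pi_gt0 R; have p1 := @pi_le_10_3 R.
have K0 : 0 < K%:R :> R.
  by have := Kbound_ge3 gamma eps; rewrite -eK ltr0n; case: (K).
have f0 : 0 < K`!%:R :> R by rewrite ltr0n fact_gt0.
set h := pi * gamma / 2.
have h0 : 0 <= h by rewrite /h; nra.
have h5 : 3 * h <= 5 * gamma by rewrite /h; nra.
have hK : h ^+ K / K`!%:R <= eps / 140.
  apply: le_trans hp; apply: (@le_trans _ _ ((3 * h / K%:R) ^+ K)).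
    have c0 : 0 < K%:R ^+ K :> R by rewrite exprn_gt0.
    have -> : (3 * h / K%:R) ^+ K =
        h ^+ K / K`!%:R * (3 ^+ K * K`!%:R / K%:R ^+ K).
      rewrite (exprMn _ (3 * h)) (exprMn _ 3) exprVn.
      move: (h ^+ K) (3 ^+ K) (K%:R ^+ K) (K`!%:R) c0 f0 => a b c f c0 f0.
      by field; rewrite !gt_eqF.
    rewrite ler_peMr ?divr_ge0 ?exprn_ge0//.
    by rewrite ler_pdivlMr// mul1r exprn_le_expR_fact.
  have h3 : 0 <= 3 * h by rewrite mulr_ge0.
  have g5 : 0 <= 5 * gamma by lra.
  by rewrite lerXn2r ?nnegrE ?ler_pM2r ?invr_gt0// divr_ge0 ?ler0n.
(* [2h = pi gamma <= 5/3 < 2], and [e^2 <= 9]. The tail is then at most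
   [18 eps / 140 <= eps / 7]. *)
have he2 : expR (h *+ 2) <= 9.
  apply: (@le_trans _ _ (expR 2)); first by rewrite ler_expR mulr2n /h; nra.
  have -> : 2 = 1 + 1 :> R by lra.
  by rewrite expRD; have := @expR1_le3 R; have := expR_gt0 (1 : R); nra.
have t0 : 0 <= h ^+ K / K`!%:R by rewrite divr_ge0 ?exprn_ge0.
by have := expR_gt0 (h *+ 2); nra.
Qed.

Lemma Kbound_bigO {R : realType} (gamma : R) : 0 < gamma <= 1 / 2 ->
  \forall e \near 0^'+,
    `|(Kbound gamma e)%:~R : R| <= 11 * `|ln (1 / e) / ln (ln (1 / e))|.
Proof.
move=> /andP[g0 g1].
have l140 : 0 <= ln 140 :> R by rewrite ln_ge0//; lra.
near=> e.
have e0 : 0 < e by near: e; exact: nbhs_right_gt.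
(* This threshold gives [l > 7 + ln 140], hence both [l > ln 140] and [l > 25/4]. *)
have ee : e < expR (- (7 + ln 140)) by near: e; apply: nbhs_right_lt; exact: expR_gt0.
have e1 : e < 1.
  by apply: lt_trans ee _; rewrite expR_lt1; lra.
set l := ln (1 / e).
have l7 : 7 + ln 140 < l.
  rewrite /l div1r lnV ?posrE// ltrNr -ltr_expR lnK//.
have [w [w0 we _ Kw]] := Kbound_LambertW gamma e (introT andP (conj e0 e1)) g0.
have eL : ln (140 / e) = ln 140 + l.
  by rewrite /l div1r lnM ?posrE ?invr_gt0//.
set k0 := 5 * gamma * expR w in we Kw.
have k00 : 0 < k0 by rewrite !mulr_gt0 ?expR_gt0.
have ll0 : 0 < ln l by apply: ln_gt0; lra.
have lnle (x : R) : 0 < x -> ln x <= x.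
  move=> x0; have : ln (1 + (x - 1)) <= x - 1 by apply: le_ln1Dx; lra.
  by rewrite addrCA subrr addr0; lra.
pose y := w * expR w.
have y0 : 0 < y by rewrite mulr_gt0 ?expR_gt0.
have ly : ln y <= 2 * w.
  rewrite /y lnM ?posrE ?expR_gt0// expRK; have := lnle _ w0; lra.
have yl : 2 / 5 * l <= y.
  have : 5 * gamma * y = ln 140 + l by rewrite -eL -we /k0 /y; ring.
  by nra.
have l4 : ln l <= 4 * w.
  (* [y >= 2 l / 5] and [l > 7] give [y ^ 2 >= l]. *)
  have : ln l <= ln (y ^+ 2) by rewrite ler_ln ?posrE ?exprn_gt0//; nra.
  by rewrite lnXn// mulr2n; lra.
(* [k0 * ln l <= 4 k0 w = 4 (ln 140 + l)], and [ln 140 < l]. *)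
have Kl : k0 * ln l <= 8 * l by nra.
apply: (@le_trans _ _ (11 * (l / ln l))); last by rewrite ler_pM2l// ler_norm.
have -> : `|(Kbound gamma e)%:~R : R| = (Kbound gamma e)%:~R.
  by apply: ger0_norm; rewrite ler0z; apply: le_trans (Kbound_ge3 _ _).
(* The constant is [11 = 3 + 8]: [3 ln l <= 3 l] for the summand 3, and [8 l] for [k0]. *)
apply: le_trans Kw _; rewrite mulrA ler_pdivlMr//.
have := lnle l ltac:(lra); lra.
Unshelve. all: by end_near.
Qed.

(** * Separated approximation of power series, and the cosine and sine series *)

(** The sum over [m < K] separates [i] from [j], so it is an entry of a matrix product of inner
    dimension [K]. The term [delta] absorbs the cut of the power series at a finite degree. *)
Lemma power_series_low_rank {R : realType} (c : nat -> R) (f : R -> R)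
    (I J : finType) (theta : I -> R) (phi : J -> R) (h delta : R) (K : nat) :
  (forall n, `|c n| <= (n`!%:R)^-1) ->
  (forall x, \sum_(n < M) c n * x ^+ n @[M --> \oo] --> f x) ->
  (forall i, `|theta i| / 2 <= h) -> 0 < delta ->
  exists g : I -> nat -> R, forall i j,
    `|f (theta i * cos (phi j)) - \sum_(m < K) g i m * cos (m%:R * phi j)| <=
    delta + 2 * (h ^+ K / K`!%:R) * expR (h *+ 2).
Proof.
move=> hc hf hh d0.
(* Finiteness of [I] and [J] makes one degree [M] serve all pairs. *)
have [M hM] : exists M, forall i j,
    `|f (theta i * cos (phi j)) -
      \sum_(n < M) c n * (theta i * cos (phi j)) ^+ n| <= delta.
  have : \forall M \near \oo, forall i j,
    `|f (theta i * cos (phi j)) -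
      \sum_(n < M) c n * (theta i * cos (phi j)) ^+ n| <= delta.
    apply: filter_forall => i; apply: filter_forall => j.
    by move/cvgr_dist_le : (hf (theta i * cos (phi j))); apply.
  by move=> [M _ hM]; exists M; apply: (hM M) => /=.
have /choice[g hg] := fun i => chebyshev_truncation c M K (theta i).
exists g => i j; rewrite -(subrKA (\sum_(n < M) c n * (theta i * cos (phi j)) ^+ n)).
apply: le_trans (ler_normD _ _) (lerD (hM i j) _).
apply: le_trans (hg i (phi j)) _.
have t0 : 0 <= `|theta i| / 2 by rewrite divr_ge0.
apply: le_trans (chebyshev_tail c M K _ t0 hc) _.
have f0 : 0 <= (K`!%:R)^-1 :> R by rewrite invr_ge0.
have h0 : 0 <= h := le_trans t0 (hh i).
apply: ler_pM; rewrite ?expR_ge0//; last by rewrite ler_expR lerMn2r hh orbT.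
by rewrite ler_pM2l// ler_wpM2r// lerXn2r ?nnegrE ?hh.
Qed.

Lemma cos_coeff_scale {R : realType} (x : R) n :
  cos_coeff x n = cos_coeff 1 n * x ^+ n.
Proof. by rewrite /cos_coeff /= expr1n mulr1 mulrAC. Qed.

Lemma sin_coeff_scale {R : realType} (x : R) n :
  sin_coeff x n = sin_coeff 1 n * x ^+ n.
Proof. by rewrite /sin_coeff /= expr1n mulr1 mulrAC. Qed.

Lemma norm_cos_coeff1 {R : realType} n : `|cos_coeff 1 n| <= (n`!%:R)^-1 :> R.
Proof.
rewrite /cos_coeff /= expr1n mulr1 !normrM normfV normr_nat -exprnP normrX normrN1 expr1n mulr1.
by rewrite ger0_norm// ler_piMl ?invr_ge0// lern1 leq_b1.
Qed.

Lemma norm_sin_coeff1 {R : realType} n : `|sin_coeff 1 n| <= (n`!%:R)^-1 :> R.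
Proof.
rewrite /sin_coeff /= expr1n mulr1 !normrM normfV normr_nat normrX normrN1 expr1n mulr1.
by rewrite ger0_norm// ler_piMl ?invr_ge0// lern1 leq_b1.
Qed.

Lemma cvg_cos_exprn {R : realType} (x : R) :
  \sum_(n < M) cos_coeff 1 n * x ^+ n @[M --> \oo] --> cos x.
Proof.
have -> : (fun M => \sum_(n < M) cos_coeff 1 n * x ^+ n) = series (cos_coeff x).
  apply/funext => M; rewrite /series /= big_mkord.
  by apply: eq_bigr => n _; rewrite [RHS]cos_coeff_scale.
by rewrite cos.unlock; exact: is_cvg_series_cos_coeff.
Qed.

Lemma cvg_sin_exprn {R : realType} (x : R) :
  \sum_(n < M) sin_coeff 1 n * x ^+ n @[M --> \oo] --> sin x.
Proof.
have -> : (fun M => \sum_(n < M) sin_coeff 1 n * x ^+ n) = series (sin_coeff x).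
  apply/funext => M; rewrite /series /= big_mkord.
  by apply: eq_bigr => n _; rewrite [RHS]sin_coeff_scale.
by rewrite sin.unlock; exact: is_cvg_series_sin_coeff.
Qed.

(** * Complex exponentials and assembly of the factorization *)

Lemma cexpiD {R : realType} (a b : R) : cexpi (a + b) = cexpi a * cexpi b.
Proof. by rewrite /cexpi cosD sinD [X in (_ +i* X)%C]addrC. Qed.

Lemma normc_cexpi {R : realType} (a : R) : Normc.normc (cexpi a) = 1.
Proof. by rewrite /cexpi /= cos2Dsin2 sqrtr1. Qed.

Lemma normc_le_norm_sum {R : rcfType} (a b : R) :
  Normc.normc (a +i* b)%C <= `|a| + `|b|.
Proof.
have s0 : 0 <= `|a| + `|b| by rewrite addr_ge0.
have -> : `|a| + `|b| = Num.sqrt ((`|a| + `|b|) ^+ 2) by rewrite sqrtr_sqr (ger0_norm s0).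
rewrite /= ler_wsqrtr//.
rewrite sqrrD !real_normK ?num_real// -addrA [_ *+ 2 + _]addrC addrA lerDl.
by rewrite mulrn_wge0// mulr_ge0.
Qed.

Lemma sum_complex {R : rcfType} (I : finType) (a b : I -> R) :
  \sum_i (a i +i* b i)%C = ((\sum_i a i) +i* (\sum_i b i))%C.
Proof.
by apply: (big_ind3 (fun x y z => x = (y +i* z)%C)) => // x1 x2 x3 y1 y2 y3 -> ->.
Qed.

Theorem theoremA2 (R : realType) (N : nat) (eps gamma : R)
    (x om : 'I_N -> R) :
  (1 <= N)%N ->
  0 < eps < 1 ->
  0 < gamma <= 1 / 2 ->
  (forall j : 'I_N, `|x j - (j : nat)%:R / N%:R| <= gamma / N%:R) ->
  (forall k : 'I_N, 0 <= om k <= N%:R) ->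
  (exists AK : 'M[R[i]]_N,
      ((\rank AK)%:Z <= Kbound gamma eps)%R /\
      mx_maxnorm (Amat N x om - AK) <= eps) /\
  (* K = O(log(1/eps) / log log(1/eps)) as eps -> 0+ *)
  (exists2 C : R, 0 < C &
     \forall e \near 0^'+,
       `|(Kbound gamma e)%:~R : R| <= C * `|ln (1 / e) / ln (ln (1 / e))|).
Proof.
move=> N1 he hg hx hom; split; last first.
  by exists 11 => //; exact: Kbound_bigO.
have N0 : 0 < N%:R :> R by rewrite ltr0n.
have p0 := @pi_gt0 R.
pose theta j := - (pi * (N%:R * (x j - (j : nat)%:R / N%:R))).
pose s k := 2 * om k / N%:R - 1.
have hth j : `|theta j| / 2 <= pi * gamma / 2.
  rewrite ler_pM2r ?invr_gt0// /theta normrN normrM gtr0_norm// ler_pM2l//.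
  by rewrite normrM gtr0_norm// mulrC -ler_pdivlMr.
have hs k : -1 <= s k <= 1.
  have /andP[om0 om1] := hom k; rewrite /s.
  have : 0 <= om k / N%:R <= 1 by rewrite divr_ge0 ?ler_pdivrMr ?mul1r// ltW.
  by rewrite -mulrA; lra.
pose phi k := acos (s k).
have cphi k : cos (phi k) = s k by rewrite acosK// in_itv/= hs.
have [K eK] : exists K : nat, K%:Z = Kbound gamma eps.
  exists `|Kbound gamma eps|%N; rewrite gez0_abs//.
  exact: le_trans (Kbound_ge3 _ _).
have tl := Kbound_tail _ _ _ he hg eK.
have /andP[e0 _] := he.
(* Each of the cosine and sine parts will cost [eps/4 + eps/7], and twice this is
   [11 eps / 14 < eps]. *)
have d0 : 0 < eps / 4 by lra.
have [gc hc] := power_series_low_rank _ _ _ _ _ phi _ _ K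
  norm_cos_coeff1 cvg_cos_exprn hth d0.
have [gs hsn] := power_series_low_rank _ _ _ _ _ phi _ _ K
  norm_sin_coeff1 cvg_sin_exprn hth d0.
(* The cosine and sine parts share the right factor [cos (m phi_k)], so complex coefficients merge
   them with inner dimension [K] instead of [2K]. The prefactor [cexpi (theta j)] only scales rows
   of [L]. *)
pose L : 'M[R[i]]_(N, K) := \matrix_(j, m) (cexpi (theta j) * (gc j m +i* gs j m)%C).
pose C : 'M[R[i]]_(K, N) := \matrix_(m, k) ((cos (m%:R * phi k))%:C)%C.
exists (L *m C); split.
  rewrite -eK lez_nat; apply: leq_trans (mxrankM_maxl _ _) _.
  exact: rank_leq_col.
apply: bigmax_le => [|j _]; first exact: ltW.
apply: bigmax_le => [|k _]; first exact: ltW.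
have -> : (Amat N x om - L *m C) j k = cexpi (theta j) *
   ((cos (theta j * cos (phi k)) - \sum_(m < K) gc j m * cos (m%:R * phi k)) +i*
    (sin (theta j * cos (phi k)) - \sum_(m < K) gs j m * cos (m%:R * phi k)))%C.
  rewrite !mxE.
  have -> : - (2 * pi * ((x j - (j : nat)%:R / N%:R) * om k)) =
      theta j + theta j * cos (phi k).
    by rewrite cphi /theta /s; field; rewrite gt_eqF.
  rewrite cexpiD.
  have -> : \sum_(m < K) L j m * C m k = cexpi (theta j) *
    ((\sum_(m < K) gc j m * cos (m%:R * phi k)) +i*
     (\sum_(m < K) gs j m * cos (m%:R * phi k)))%C.
    rewrite -sum_complex mulr_sumr; apply: eq_bigr => m _.
    rewrite !mxE -mulrA; congr (_ * _).
    by apply/eqP; rewrite eq_complex /= !mulr0 subr0 add0r !eqxx.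
  by rewrite -mulrBr.
(* The prefactor has modulus 1, so only the real and imaginary errors remain. *)
rewrite Normc.normcM normc_cexpi mul1r; apply: le_trans (normc_le_norm_sum _ _) _.
have := hc j k; have := hsn j k; lra.
Qed.
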